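(* Let $G$ be a finite abelian group of order $n$ and $S\subset G^n$ the set of bijections $\{1,\dots,n\}\to G$. Let $0\le\delta\le 1/2$, and let $\chi\in\hat G^n$ be a character with exactly $m$ nontrivial coordinates, where $m\le n/2$, such that no nontrivial character $\chi_0\in\hat G$ with $2\chi_0=0$ occurs as a coordinate of $\chi$ more than $(1-\delta)m$ times. Then \[ |\widehat{1_S}(\chi)|\le e^{O(m^{3/2}/n^{1/2}+m^{1/2})}(1-\delta)^{m/2}\binom{n}{m}^{-1/2}\frac{n!}{n^n}, \] where the implied constant is absolute.
   Context: $\hat G$ is the dual group of $G$, written additively with $0$ the trivial character. For $\chi=(\chi_1,\dots,\chi_n)\in\hat G^n$, $\widehat{1_S}(\chi)=\frac{1}{n^n}\sum_{\pi\in S}\prod_{i=1}^n\chi_i(\pi(i))$. *)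

(* Defs.v *)
From HB Require Import structures.
From mathcomp Require Import all_boot all_order all_algebra.
From mathcomp Require Import reals.
From mathcomp.analysis Require Import sequences exp.
From mathcomp.real_closed Require Import complex.
Set Implicit Arguments. Unset Strict Implicit. Unset Printing Implicit Defensive.
Import Order.TTheory GRing.Theory Num.Theory.
Local Open Scope ring_scope.

Definition is_character (R : rcfType) (G : finZmodType) (c : {ffun G -> R[i]}) :=
  c 0 = 1 /\ forall x y : G, c (x + y) = c x * c y.

Definition triv_char (R : rcfType) (G : finZmodType) : {ffun G -> R[i]} :=
  [ffun _ => 1].

Definition order_le2 (R : rcfType) (G : finZmodType) (c : {ffun G -> R[i]}) :=
  forall x : G, c x ^+ 2 = 1.

Definition bijS (G : finZmodType) (n : nat) : {set {ffun 'I_n -> G}} :=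
  [set p : {ffun 'I_n -> G} | injectiveb p && (#|G| == n)%N].

Definition hat1S (R : rcfType) (G : finZmodType) (n : nat)
  (chi : 'I_n -> {ffun G -> R[i]}) : R[i] :=
  (n%:R ^+ n)^-1 * \sum_(p in bijS G n) \prod_(i < n) chi i (p i).

Definition n_nontriv (R : rcfType) (G : finZmodType) (n : nat)
  (chi : 'I_n -> {ffun G -> R[i]}) : nat :=
  #|[set i : 'I_n | chi i != triv_char R G]|.

Definition mult_coord (R : rcfType) (G : finZmodType) (n : nat)
  (chi : 'I_n -> {ffun G -> R[i]}) (c : {ffun G -> R[i]}) : nat :=
  #|[set i : 'I_n | chi i == c]|.

(* Main.v *)
Require Import Defs.
From HB Require Import structures.
From mathcomp Require Import all_boot all_order all_algebra all_fingroup cyclic ring lra zify.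
From mathcomp Require Import reals.
From mathcomp.analysis Require Import sequences exp.
From mathcomp.real_closed Require Import complex.
Import Order.TTheory GRing.Theory Num.Theory.
Import Normc.
Set Implicit Arguments. Unset Strict Implicit. Unset Printing Implicit Defensive.
Local Open Scope ring_scope.

(** Let T be the set of the m nontrivial coordinates. Summing the value at a
    pivot coordinate over the points which the other coordinates leave free
    shows that the character sum over injections T -> G is, in absolute value,
    at most the sum of n^(number of cycles) over the permutations of T whose
    cycles all have a trivial product of characters. Such a permutation has no
    fixed point, and its 2-cycles match each character with its inverse; cycles
    of length at least 3 are left unrestricted.

    If K is the union of the 2-cycles and k_psi is the multiplicity of psi in K,
    then the number of matchings is at most (prod_psi k_psi!)^(1/2), and it
    vanishes unless psi and psi^-1 have the same multiplicity. Hence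
    k_psi <= |K| / 2 if psi^2 is nontrivial, and k_psi <= L := (1 - delta) m by
    hypothesis otherwise. As m <= 2 L, log-convexity of the factorial gives
    prod_psi k_psi! <= (e m)^O(1) (L / e)^|K|. The longer cycles on j points
    contribute at most j! r^-j exp(2 n r^3), by the exponential generating
    function at r = 6 (m / n)^(1/2), so that the sum over K is dominated by a
    geometric series whose largest term is (L n / e)^(m / 2). For m > n / 144
    the trivial bound n! / n^n suffices. *)

(** * The pivot recursion *)

Definition char_mul (R : rcfType) (G : finZmodType) (c d : {ffun G -> R[i]}) :
  {ffun G -> R[i]} := [ffun x => c x * d x].

Lemma is_character_mul (R : rcfType) (G : finZmodType) (c d : {ffun G -> R[i]}) :
  is_character c -> is_character d -> is_character (char_mul c d).
Proof.
move=> [c0 cD] [d0 dD]; split; first by rewrite ffunE c0 d0 mulr1.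
by move=> x y; rewrite !ffunE cD dD mulrACA.
Qed.

Lemma sum_character (R : rcfType) (G : finZmodType) (c : {ffun G -> R[i]}) :
  is_character c -> \sum_x c x = (#|G| * (c == triv_char R G))%:R.
Proof.
move=> [c0 cD]; have [->|nc] := eqVneq c; rewrite ?muln1 ?muln0.
  by under eq_bigr do rewrite ffunE; rewrite sumr_const.
have /existsP[y cy] : [exists y, c y != 1].
  rewrite -negb_forall; apply: contra nc => /forallP h.
  by apply/eqP/ffunP => x; rewrite ffunE; apply/eqP/h.
have : (c y - 1) * \sum_x c x = 0.
  rewrite mulrBl mul1r mulr_sumr [X in _ - X](reindex_inj (addrI y)) -sumrB.
  by rewrite big1 // => x _; rewrite cD subrr.
by move/eqP; rewrite mulf_eq0 subr_eq0 (negPf cy) => /eqP.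
Qed.

Lemma normc_character (R : rcfType) (G : finZmodType) (c : {ffun G -> R[i]}) x :
  is_character c -> `|c x| = 1.
Proof.
move=> [c0 cD].
have cM k : c (x *+ k) = c x ^+ k.
  by elim: k => [|k IH]; rewrite ?mulr0n ?c0 // mulrS cD IH exprS.
have G0 : (0 < #|G|)%N by apply/card_gt0P; exists 0.
apply/eqP; rewrite -(pexpr_eq1 G0) // -normrX -cM.
have -> : x *+ #|G| = 0.
  by rewrite -FinRing.zmodXgE -cardsT; apply: (expg_cardG (G := [set: G])); rewrite inE.
by rewrite c0 normr1.
Qed.

Definition bij_sum (R : rcfType) (G : finZmodType) (n : nat)
    (chi : 'I_n -> {ffun G -> R[i]}) (T : {set 'I_n}) : R[i] :=
  \sum_(p in bijS G n) \prod_(i in T) chi i (p i).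

(** The pivot [a] carries [c], the product of the characters along the path opened so far. *)
Definition pivot_sum (R : rcfType) (G : finZmodType) (n : nat)
    (chi : 'I_n -> {ffun G -> R[i]}) (a : 'I_n) (c : {ffun G -> R[i]})
    (T : {set 'I_n}) : R[i] :=
  \sum_(p in bijS G n) c (p a) * \prod_(i in T) chi i (p i).

Section PivotRecursion.
Variables (R : rcfType) (G : finZmodType) (n : nat).
Variable chi : 'I_n -> {ffun G -> R[i]}.
Implicit Types (a b : 'I_n) (c : {ffun G -> R[i]}) (T : {set 'I_n}).

Lemma bij_sumU1 a T : a \notin T ->
  bij_sum chi (a |: T) = pivot_sum chi a (chi a) T.
Proof. by move=> aT; apply: eq_bigr => p _; rewrite big_setU1. Qed.

(** Precomposing with the transposition of [a] and [b] permutes the bijections and leaves the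
    product over [T] unchanged. *)
Lemma pivot_sum_swap a b c T : a \notin T -> b \notin T ->
  pivot_sum chi a c T = pivot_sum chi b c T.
Proof.
move=> aT bT; pose h (p : {ffun 'I_n -> G}) := [ffun i => p (tperm a b i)].
have hK : involutive h.
  by move=> p; apply/ffunP => i; rewrite !ffunE tpermK.
rewrite /pivot_sum (reindex_inj (inv_inj hK)); apply: eq_big => [p|p _].
  rewrite !inE; congr (_ && _); apply/injectiveP/injectiveP => inj_p i j.
    move=> e; apply: (@perm_inj _ (tperm a b)); apply: inj_p.
    by rewrite !ffunE !tpermK.
  by rewrite !ffunE => /inj_p/perm_inj.
rewrite ffunE tpermL; congr (_ * _); apply: eq_bigr => i iT.
by rewrite ffunE tpermD //; [apply: contraNneq aT|apply: contraNneq bT] => ->.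
Qed.

Lemma sum_bijS c (p : {ffun 'I_n -> G}) : p \in bijS G n ->
  \sum_i c (p i) = \sum_x c x.
Proof.
rewrite inE => /andP[/injectiveP inj_p /eqP cG].
have bij_p : bijective p by apply: inj_card_bij => //; rewrite cG card_ord.
by rewrite [RHS](reindex _ (onW_bij _ bij_p)).
Qed.

(** By [pivot_sum_swap] all n - #|T| pivots outside [T] give the same value. Summing over them
    leaves the full sum of [c] minus its values at the points of [T], and the value at [i] merges
    with [chi i]. *)
Lemma pivot_sum_rec a c T : a \notin T ->
  (n - #|T|)%:R * pivot_sum chi a c T =
  (\sum_x c x) * bij_sum chi T
  - \sum_(i in T) pivot_sum chi i (char_mul c (chi i)) (T :\ i).
Proof.
move=> aT; have -> : (n - #|T|)%N = #|~: T| by rewrite [RHS]cardsCs setCK card_ord.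
rewrite mulr_natl -sumr_const.
rewrite (eq_bigr (fun b => pivot_sum chi b c T)) => [|b]; last first.
  by rewrite inE => bT; apply: pivot_sum_swap.
rewrite exchange_big /= mulr_sumr [X in _ - X]exchange_big -sumrB.
apply: eq_bigr => p bp; rewrite -(sum_bijS c bp) -mulr_suml.
rewrite [\sum_i c (p i)](bigID (mem T)) /= mulrDl [X in X + _]addrC.
rewrite (eq_bigl (fun i => i \notin T)) => [|i]; last by rewrite inE.
rewrite [X in _ + X - _]mulr_suml [X in _ + X - _](eq_bigr (fun i =>
  char_mul c (chi i) (p i) * \prod_(j in T :\ i) chi j (p j))) ?addrK // => i iT.
by rewrite (big_setD1 i iT) /= ffunE mulrA.
Qed.

End PivotRecursion.

(** * Matchings of opposite characters *)

Section SubsetSums.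
Variables (I : finType) (V : nmodType).
Implicit Types (T K L : {set I}).

Lemma sum_subsetU1 a T (h : {set I} -> V) : a \notin T ->
  \sum_(K : {set I} | K \subset a |: T) h K =
  \sum_(K : {set I} | K \subset T) h K + \sum_(K : {set I} | K \subset T) h (a |: K).
Proof.
move=> aT; rewrite (bigID (fun K : {set I} => a \notin K)) /=; congr (_ + _).
  by apply: eq_bigl => K; rewrite -subsetD1 setU1K.
rewrite (reindex_onto (fun K => a |: K) (fun K => K :\ a)) /=; last first.
  by move=> K /andP[_]; rewrite negbK => /setD1K.
apply: eq_bigl => K; rewrite setU11 /= andbT; apply/andP/idP => [[]|KT].
  move=> sK /eqP eK; have aK : a \notin K by rewrite -eK setD11.
  by rewrite -(setU1K aK) -(setU1K aT) setSD.
by rewrite setUS // setU1K //; apply: contra aT => /(subsetP KT).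
Qed.

Lemma sum_subset_del T (f : I -> {set I} -> V) :
  \sum_(i in T) \sum_(K : {set I} | K \subset T :\ i) f i K =
  \sum_(L : {set I} | L \subset T) \sum_(i in L) f i (L :\ i).
Proof.
rewrite [RHS](exchange_big_dep (mem T)) /=; last by move=> L i /subsetP sLT /sLT.
apply: eq_bigr => i iT.
rewrite [RHS](reindex_onto (fun K => i |: K) (fun K => K :\ i)) /=; last first.
  by move=> K /andP[_ /setD1K].
apply: eq_big => [K|K]; last first.
  by rewrite subsetD1 => /andP[_ iK]; rewrite setU1K.
rewrite setU11 andbT subsetD1; apply/andP/andP => [[KT iK]|[KT /eqP eK]].
  by rewrite setU1K // subUset sub1set iT.
by rewrite -eK setD11 (subset_trans _ KT) // subsetDl.
Qed.

Lemma sum_subset_avoid T (g : {set I} -> V) :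
  \sum_(i in T) \sum_(K : {set I} | K \subset T :\ i) g K =
  \sum_(K : {set I} | K \subset T) g K *+ (#|T| - #|K|).
Proof.
rewrite (exchange_big_dep (fun K : {set I} => K \subset T)) /=; last first.
  by move=> i K _; rewrite subsetD1 => /andP[].
apply: eq_bigr => K KT.
have -> : (#|T| - #|K|)%N = #|T :\: K| by rewrite cardsD (setIidPr KT).
by rewrite -sumr_const; apply: eq_bigl => i; rewrite subsetD1 KT /= !inE andbC.
Qed.

End SubsetSums.

(** The sequence k!^(1/k) is nondecreasing: from p to p + 1 the left side gains the factor k!, the
    right side (p + 1)^k. *)
Lemma expn_fact_le k p : (k <= p)%N -> (k`! ^ p <= p`! ^ k)%N.
Proof.
elim: p => [|p IH]; first by rewrite leqn0 => /eqP->.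
rewrite leq_eqVlt ltnS => /orP[/eqP-> //|kp].
have fact_le l q : (l <= q)%N -> (l`! <= q ^ l)%N.
  by elim: l => // l IHl lq; rewrite factS expnS leq_mul // IHl // ltnW.
by rewrite expnS factS expnMn leq_mul ?IH // fact_le // leqW.
Qed.

Section Pairings.
Variables (I J : finType) (t : I -> J) (opp : rel I).
Hypothesis opp_sym : symmetric opp.
Hypothesis opp_same : forall a i l, opp a i -> (t a == t l) = opp i l.
Implicit Types (a i l : I) (K L : {set I}).

Definition class_card K (j : J) : nat := #|[set i in K | t i == j]|.

(** The members of [K] opposite to [l] form the inverse class of [l], so inverse classes are equally
    large, as a perfect matching by opposite pairs forces. This form needs no inverse map on [J]. *)
Definition balanced K : bool :=
  [forall l, class_card K (t l) == #|[set i in K | opp i l]|].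

Definition class_fact K : nat := (\prod_(j : J) (class_card K j)`!)%N.

Lemma card_set_inU1 (P : pred I) a K : a \notin K ->
  #|[set i in a |: K | P i]| = (P a + #|[set i in K | P i]|)%N.
Proof.
by move=> aK; rewrite -!sum1dep_card !big_mkcondr /= big_setU1 //=; case: (P a).
Qed.

Lemma class_cardU1 a K j : a \notin K ->
  class_card (a |: K) j = ((t a == j) + class_card K j)%N.
Proof. exact: card_set_inU1. Qed.

Lemma class_factU1 a K : a \notin K ->
  class_fact (a |: K) = (class_card (a |: K) (t a) * class_fact K)%N.
Proof.
move=> aK; rewrite /class_fact (bigD1 (t a)) //= [in RHS](bigD1 (t a)) //=.
rewrite mulnA class_cardU1 // eqxx add1n -factS; congr (_ * _)%N.
by apply: eq_bigr => j ja; rewrite class_cardU1 // eq_sym (negPf ja).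
Qed.

Lemma balancedU2 a i K : a \notin i |: K -> i \notin K -> opp a i ->
  balanced K -> balanced (a |: (i |: K)).
Proof.
move=> aK iK ai /forallP bK; apply/forallP => l.
rewrite !class_cardU1 // !card_set_inU1 // (eqP (bK l)) (opp_same _ ai).
have ia : opp i a by rewrite opp_sym.
by rewrite (opp_same _ ia) addnCA.
Qed.

Lemma sum_class_card K : (\sum_j class_card K j = #|K|)%N.
Proof.
rewrite -sum1_card (partition_big t predT) //=.
by apply: eq_bigr => j _; rewrite /class_card -sum1dep_card.
Qed.

Lemma class_fact_le K p : (forall j, class_card K j <= p)%N ->
  (class_fact K ^ p <= p`! ^ #|K|)%N.
Proof.
move=> Kp; rewrite -sum_class_card expn_sum /class_fact.
rewrite (big_morph (fun k => k ^ p)%N (id1 := 1%N) (op1 := muln)) //; first last.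
- by rewrite exp1n.
- by move=> x y; rewrite expnMn.
by apply: leq_prod => j _; apply: expn_fact_le.
Qed.

(** As [l] is not opposite to itself, its class and the inverse class are disjoint in [K], and
    balance makes them equally large. *)
Lemma class_card_balanced K l : balanced K -> ~~ opp l l ->
  (2 * class_card K (t l) <= #|K|)%N.
Proof.
move=> /forallP/(_ l)/eqP bK nll; rewrite mul2n -addnn {2}bK.
have AB0 : [set i in K | t i == t l] :&: [set i in K | opp i l] = set0.
  apply/eqP/set0Pn => -[k]; rewrite !inE.
  case/andP=> /andP[_ /eqP tkl] /andP[_ kl]; move: nll.
  by rewrite -(opp_same l kl) tkl eqxx.
rewrite /class_card -cardsUI AB0 cards0 addn0; apply/subset_leq_card/subsetP => i.
by rewrite !inE => /orP[] /andP[].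
Qed.

Variable R : rcfType.

(* Bounds the number of perfect matchings of [K] by [opp]-pairs. *)
Definition pairing_bound K : R := (balanced K)%:R * Num.sqrt (class_fact K)%:R.

Lemma pairing_bound_ge0 K : 0 <= pairing_bound K.
Proof. by rewrite mulr_ge0 ?ler0n ?sqrtr_ge0. Qed.

Lemma pairing_bound0 : pairing_bound set0 = 1.
Proof.
have s0 (P : pred I) : #|[set i in set0 | P i]| = 0%N.
  by apply: eq_card0 => i; rewrite !inE.
rewrite /pairing_bound /class_fact big1 => [|j _]; last by rewrite /class_card s0.
have -> : balanced set0 by apply/forallP => l; rewrite /class_card !s0.
by rewrite sqrtr1 mulr1.
Qed.

(* With [d] the number of admissible partners of [a], every [L :\ i] satisfies
   [d ^ 2 * class_fact (L :\ i) <= class_fact (a |: L)], because by balance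
   the class of [a] has at least [d] elements. *)
Lemma sum_pairing_bound a L : a \notin L ->
  \sum_(i in L | opp a i) pairing_bound (L :\ i) <= pairing_bound (a |: L).
Proof.
move=> aL; set D := [set i in L | opp a i].
have termP i : i \in D -> #|D|%:R * pairing_bound (L :\ i) <= pairing_bound (a |: L).
  rewrite inE => /andP[iL ai]; rewrite /pairing_bound.
  have iLi : i \notin L :\ i by rewrite setD11.
  have aiL : a \notin i |: L :\ i by rewrite setD1K.
  have ia : opp i a by rewrite opp_sym.
  case bLi: (balanced (L :\ i)); last by rewrite mul0r mulr0 pairing_bound_ge0.
  have := balancedU2 aiL iLi ai bLi; rewrite setD1K // => baL.
  rewrite baL !mul1r -[#|D|%:R]ger0_norm // -sqrtr_sqr -sqrtrM ?sqr_ge0 //.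
  rewrite ler_sqrt // -natrX -natrM ler_nat class_factU1 //.
  have -> : class_fact L = (#|D| * class_fact (L :\ i))%N.
    rewrite -{1}(setD1K iL) class_factU1 // setD1K //; congr (_ * _)%N.
    by apply: eq_card => l; rewrite !inE [t l == _]eq_sym (opp_same _ ia).
  rewrite expnS expn1 -mulnA leq_mul //.
  rewrite (eqP (forallP baL a)); apply/subset_leq_card/subsetP => l.
  by rewrite !inE opp_sym => /andP[-> ->]; rewrite orbT.
have eD i : (i \in L) && opp a i = (i \in D) by rewrite inE.
have [D0|D_gt0] := posnP #|D|.
  rewrite big_pred0 ?pairing_bound_ge0 // => i.
  by rewrite eD (card0_eq D0).
rewrite (eq_bigl _ _ eD) -(ler_pM2l (_ : 0 < #|D|%:R :> R)) ?ltr0n // mulr_sumr.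
by apply: (le_trans (ler_sum _ termP)); rewrite sumr_const mulr_natl.
Qed.

End Pairings.

(** * Factorials and long cycles *)

Lemma fact_ge_expR (R : realType) m : (m%:R / expR 1) ^+ m <= m`!%:R :> R.
Proof.
case: m => [|m]; first by rewrite expr0.
rewrite expr_div_n -expRM_natl mulr1 ler_pdivrMr ?expR_gt0 // mulrC.
rewrite -ler_pdivrMr ?ltr0n ?fact_gt0 //.
by apply: le_trans (expR_ge1Dxn m (ler0n R m.+1)); rewrite lerDr.
Qed.

(** Induction on p, the step being (1 - 1/(p+2))^(p+2) <= 1/e. *)
Lemma fact_le_expR (R : realType) p :
  p.+1`!%:R <= expR 1 * p.+1%:R * (p.+1%:R / expR 1) ^+ p.+1 :> R.
Proof.
have e0 : expR 1 != 0 :> R by rewrite gt_eqF ?expR_gt0.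
elim: p => [|p IH]; first by rewrite expr1 mulr1 mulrCA divff ?mulr1.
have p2 : 0 < p.+2%:R :> R by rewrite ltr0n.
rewrite factS natrM (le_trans (ler_wpM2l (ltW p2) IH)) //.
have key : (p.+1%:R / p.+2%:R) ^+ p.+2 <= (expR 1)^-1 :> R.
  have -> : p.+1%:R / p.+2%:R = 1 + - p.+2%:R^-1 :> R.
    by field; apply: lt0r_neq0; have := ler0n R p; lra.
  apply: (@le_trans _ _ (expR (- p.+2%:R^-1) ^+ p.+2)).
    rewrite lerXn2r ?nnegrE ?expR_ge0 ?expR_ge1Dx //.
    by rewrite subr_ge0 invf_le1 // ler1n.
  by rewrite -expRM_natl mulrN divff ?gt_eqF // expRN.
have -> : p.+2%:R * ((expR 1 : R) * p.+1%:R * (p.+1%:R / expR 1) ^+ p.+1) =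
   p.+2%:R * (expR 1) ^+ 2 * (p.+2%:R / expR 1) ^+ p.+2 * (p.+1%:R / p.+2%:R) ^+ p.+2.
  rewrite !expr_div_n [p.+1%:R ^+ p.+2]exprS [expR 1 ^+ p.+2]exprS.
  have := lt0r_neq0 (exprn_gt0 p.+2 p2).
  have := lt0r_neq0 (exprn_gt0 p.+1 (expR_gt0 (1 : R))).
  move: (expR 1) (expR 1 ^+ p.+1) (p.+2%:R ^+ p.+2) (p.+1%:R ^+ p.+1) e0.
  move: p.+2%:R p.+1%:R => z y e E B A e0 E0 B0.
  by field; rewrite e0 E0 B0.
apply: le_trans (ler_wpM2l _ key) _.
  by rewrite !(exprn_ge0, invr_ge0, expR_ge0, mulr_ge0).
rewrite le_eqVlt; apply/orP; left; apply/eqP.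
move: (_ ^+ p.+2) => B.
by field.
Qed.

Section Supersolution.
Variables (R : realType) (nu r : R).
Hypotheses (nu0 : 0 <= nu) (r0 : 0 < r) (r_le : r <= 2^-1).

(** Truncation at degree j makes [exp_partialS] hold for every x >= 0; with the full exponential it
    would fail for x > j + 1. *)
Definition exp_partial (x : R) (j : nat) : R := \sum_(k < j.+1) x ^+ k / k`!%:R.

Lemma exp_partial_mono (x : R) j : 0 <= x -> exp_partial x j <= exp_partial x j.+1.
Proof.
by move=> x0; rewrite [leRHS]big_ord_recr lerDl divr_ge0 ?exprn_ge0.
Qed.

Lemma exp_partial_ge0 (x : R) j : 0 <= x -> 0 <= exp_partial x j.
Proof. by move=> x0; apply: sumr_ge0 => k _; rewrite divr_ge0 ?exprn_ge0. Qed.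

Lemma exp_partial_le (x : R) j : 0 <= x -> exp_partial x j <= expR x.
Proof.
move=> x0; have -> : exp_partial x j = series (exp_coeff x) j.+1.
  by rewrite /series /= big_mkord.
apply: nondecreasing_cvgn_le; last exact: is_cvg_series_exp_coeff.
apply/nondecreasing_seqP => i.
by rewrite /series /= big_nat_recr //= lerDl exp_coeff_ge0.
Qed.

Lemma exp_partialS (x : R) j : 0 <= x ->
  x * exp_partial x j <= j.+1%:R * exp_partial x j.+1.
Proof.
move=> x0; rewrite /exp_partial [X in _ <= _ * X]big_ord_recl mulrDr !mulr_sumr.
rewrite -[leLHS]add0r lerD ?mulr_ge0 ?divr_ge0 ?exprn_ge0 ?invr_ge0 //.
apply: ler_sum => k _; rewrite lift0.
have -> : x * (x ^+ k / k`!%:R) = k.+1%:R * (x ^+ k.+1 / k.+1`!%:R).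
  have k0 : k`!%:R != 0 :> R by rewrite pnatr_eq0 -lt0n fact_gt0.
  by rewrite exprS factS natrM; field; rewrite k0 ?nat1r ?natr1 pnatr_eq0.
by rewrite ler_wpM2r ?divr_ge0 ?exprn_ge0 // ler_nat ltn_ord.
Qed.

(** Collects the factor 2 nu of [path_bound] and the r^3 gained when three points are removed, so
    that [cycle_bound_rec] reduces to [exp_partialS]. *)
Let x : R := 2 * nu * r ^+ 3.

Let x_ge0 : 0 <= x.
Proof. by rewrite !mulr_ge0 ?exprn_ge0 // ltW. Qed.

(* Bounds the sum of [nu ^ (number of cycles)] over the permutations of [j]
   points without cycles of length 1 or 2, whose exponential generating function
   is [exp (nu (z^3/3 + z^4/4 + ...))]: it is a supersolution of the recursion
   which removes the cycle of a given point. *)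
Definition cycle_bound (j : nat) : R := j`!%:R * exp_partial x j / r ^+ j.

(* The analogue when one further point starts an open path on the [j] points. *)
Definition path_bound (j : nat) : R := 2 * nu * cycle_bound j.

Lemma cycle_bound_ge0 j : 0 <= cycle_bound j.
Proof. by rewrite !mulr_ge0 ?exp_partial_ge0 ?invr_ge0 ?exprn_ge0 // ltW. Qed.

Lemma cycle_bound0 : cycle_bound 0 = 1.
Proof. by rewrite /cycle_bound /exp_partial big_ord1 !expr0 !divr1 mulr1. Qed.

Lemma cycle_bound_rec j :
  (j.+2 * j.+1)%:R * path_bound j <= cycle_bound j.+3.
Proof.
have rj : 0 < r ^+ j by rewrite exprn_gt0.
rewrite /path_bound /cycle_bound.
have -> : (j.+2 * j.+1)%:R * (2 * nu * (j`!%:R * exp_partial x j / r ^+ j)) =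
   (j.+2`!%:R / r ^+ j.+3) * (x * exp_partial x j).
  rewrite !factS !natrM /x !exprS; field; rewrite !gt_eqF //.
have -> : j.+3`!%:R * exp_partial x j.+3 / r ^+ j.+3 =
   (j.+2`!%:R / r ^+ j.+3) * (j.+3%:R * exp_partial x j.+3).
  by rewrite factS natrM; ring.
rewrite ler_wpM2l ?divr_ge0 ?exprn_ge0 ?(ltW r0) //.
apply: le_trans (exp_partialS j.+2 x_ge0).
by rewrite ler_wpM2l // (le_trans (exp_partial_mono j x_ge0)) // exp_partial_mono.
Qed.

Lemma path_bound0 : nu * cycle_bound 0 <= path_bound 0.
Proof. by rewrite /path_bound cycle_bound0 !mulr1; move: nu0; lra. Qed.

(** The factor 2 in [path_bound] provides one share for closing the path and one for extending it; r
    <= 1/2 makes the second share suffice. *)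
Lemma path_bound_rec j :
  nu * cycle_bound j.+1 + j.+1%:R * path_bound j <= path_bound j.+1.
Proof.
have rj : 0 < r ^+ j by rewrite exprn_gt0.
suff : 2 * j.+1%:R * cycle_bound j <= cycle_bound j.+1.
  by move=> h; have := ler_wpM2l nu0 h; rewrite /path_bound; lra.
have -> : 2 * j.+1%:R * cycle_bound j =
    (j.+1`!%:R / r ^+ j.+1) * ((2 * r) * exp_partial x j).
  by rewrite /cycle_bound factS natrM exprS; field; rewrite !gt_eqF.
have -> : cycle_bound j.+1 = (j.+1`!%:R / r ^+ j.+1) * exp_partial x j.+1.
  by rewrite /cycle_bound; ring.
rewrite ler_wpM2l ?divr_ge0 ?exprn_ge0 ?(ltW r0) //.
apply: le_trans (exp_partial_mono j x_ge0).
rewrite ler_piMl ?exp_partial_ge0 //; move: r_le; lra.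
Qed.

End Supersolution.

Lemma sqrtr_le_sqr (R : rcfType) (x y : R) : 0 <= y -> x <= y ^+ 2 -> Num.sqrt x <= y.
Proof. by move=> y0 xy; rewrite -[leRHS]ger0_norm // -sqrtr_sqr ler_wsqrtr. Qed.

Section PairingEstimate.
Variables (R : realType) (I J : finType) (t : I -> J) (opp : rel I).
Hypothesis opp_same : forall a i l, opp a i -> (t a == t l) = opp i l.

(** Every class has at most p = floor L members: self-opposite ones by hypothesis, the others
    because they fill at most half of [K] and m/2 <= L. Then [class_fact_le] and the Stirling bound
    on p! apply. *)
Lemma pairing_bound_le (K : {set I}) (m : nat) (L : R) :
  (0 < m)%N -> (#|K| <= m)%N -> m%:R <= 2 * L -> L <= m%:R ->
  (forall l, opp l l -> (class_card t K (t l))%:R <= L) ->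
  pairing_bound t opp R K <= (expR 1 * m%:R) ^+ 2 * Num.sqrt (L / expR 1) ^+ #|K|.
Proof.
move=> m0 Km mL Lm classL.
have e_ge1 : 1 <= expR 1 :> R by rewrite -[leLHS]expR0 ler_expR.
have m_ge1 : 1 <= m%:R :> R by rewrite ler1n.
have em_ge1 : 1 <= expR 1 * m%:R :> R by rewrite -[leLHS]mulr1 ler_pM.
have L0 : 0 <= L by lra.
rewrite /pairing_bound; case bK: (balanced t opp K); last first.
  by rewrite mul0r mulr_ge0 ?exprn_ge0 ?sqrtr_ge0 // (le_trans _ em_ge1).
rewrite mul1r; pose p := Num.truncn L.
have class_p j : (class_card t K j <= p)%N.
  have [->//|] := posnP (class_card t K j).
  case/card_gt0P=> i; rewrite inE => /andP[_ /eqP<-].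
  rewrite /p truncn_ge_nat //; have [/classL//|nii] := boolP (opp i i).
  have := leq_trans (class_card_balanced opp_same bK nii) Km.
  rewrite -(ler_nat R) natrM; lra.
apply: sqrtr_le_sqr.
  by rewrite mulr_ge0 ?exprn_ge0 ?sqrtr_ge0 // (le_trans _ em_ge1).
have Le0 : 0 <= L / expR 1 by rewrite divr_ge0 ?expR_ge0.
rewrite exprMn -exprM [(_ ^+ #|K|) ^+ 2]exprAC sqr_sqrtr //.
have := class_fact_le class_p.
have pL : p%:R <= L by rewrite /p truncn_le.
have pL1 : L < p.+1%:R by rewrite /p truncnS_gt.
(* If floor L = 0, all classes are empty, hence so is [K]. *)
case: p pL pL1 class_p => [|p] pL pL1 class_p.
  move=> _; have K0 : #|K| = 0%N.
    by rewrite -(sum_class_card t) big1 // => j _; apply/eqP; rewrite -leqn0.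
  rewrite /class_fact K0 expr0 mulr1 big1 ?exprn_ege1 // => j _.
  by have := class_p j; rewrite leqn0 => /eqP->.
rewrite -(ler_nat R) !natrX => F_le.
rewrite -(@ler_pXn2r _ p.+1) ?nnegrE ?mulr_ge0 ?exprn_ge0 ?expR_ge0 //.
apply: le_trans F_le _.
apply: (@le_trans _ _ ((expR 1 * p.+1%:R * (p.+1%:R / expR 1) ^+ p.+1) ^+ #|K|)).
  rewrite lerXn2r ?nnegrE ?fact_le_expR // !(exprn_ge0, invr_ge0, expR_ge0, mulr_ge0) //.
(* Here [p.+1] is floor L. Since #|K| <= m <= 3 (p+1), the Stirling prefactor (e (p+1))^#|K| fits
   into (e m)^(4 (p+1)). *)
have p3 : (m <= 3 * p.+1)%N.
  have : m%:R < (2 * p.+2)%:R :> R by rewrite natrM; lra.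
  rewrite ltr_nat; lia.
rewrite [leLHS]exprMn [leRHS]exprMn [(_ ^+ p.+1) ^+ #|K|]exprAC ler_pM //; last first.
- rewrite lerXn2r ?nnegrE ?exprn_ge0 //; last first.
    by rewrite lerXn2r ?nnegrE // ?ler_pM2r ?invr_gt0 ?expR_gt0 // divr_ge0 ?expR_ge0.
  by rewrite divr_ge0 ?expR_ge0.
- apply: (@le_trans _ _ ((expR 1 * m%:R) ^+ #|K|)).
    rewrite lerXn2r ?nnegrE ?mulr_ge0 ?expR_ge0 // ler_pM2l ?expR_gt0 //; lra.
  by rewrite -exprM ler_weXn2l //; lia.
- by rewrite !exprn_ge0 // divr_ge0 ?expR_ge0.
- by rewrite exprn_ge0 // mulr_ge0 ?expR_ge0.
Qed.
End PairingEstimate.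

(** * Majorization of the character sums *)

Lemma normc_sum_le (R : rcfType) (I : finType) (P : pred I) (F : I -> R[i]) :
  normc (\sum_(i | P i) F i) <= \sum_(i | P i) normc (F i).
Proof.
elim/big_ind2: _ => [|x1 x2 y1 y2 h1 h2|//]; first by rewrite normc0.
by apply: le_trans (le_normcD _ _) _; apply: lerD.
Qed.

Lemma normc_nat (R : rcfType) (k : nat) : normc k%:R = k%:R :> R.
Proof. by rewrite -[k%:R]/(1 *+ k) normcMn normc1. Qed.

Lemma normC_normc (R : rcfType) (z : R[i]) : `|z| = (normc z)%:C%C.
Proof. by case: z => a b; rewrite normc_def. Qed.

Section Majorant.
Variables (R : realType) (G : finZmodType) (n : nat).
Variable chi : 'I_n -> {ffun G -> R[i]}.
Hypothesis cardG : #|G| = n.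
Hypothesis chi_char : forall i, is_character (chi i).
Implicit Types (a i : 'I_n) (c : {ffun G -> R[i]}) (T K L : {set 'I_n}).

Definition opposite a i : bool := char_mul (chi a) (chi i) == triv_char R G.

(** Each injection T -> G extends to (n - #|T|)! bijections, so this is the absolute value of the
    sum over injections; [pivot_norm] also counts the pivot. *)
Definition bij_norm T : R := normc (bij_sum chi T) / (n - #|T|)`!%:R.

Definition pivot_norm a c T : R :=
  normc (pivot_sum chi a c T) / (n - #|T|.+1)`!%:R.

Lemma card_lt_notin a T : a \notin T -> (#|T| < n)%N.
Proof.
move=> aT; rewrite -[X in (_ < X)%N]card_ord -cardsT.
by apply: proper_card; rewrite properT; apply: contraNneq aT => ->; rewrite inE.
Qed.

Lemma normc_bij_sum_le T : normc (bij_sum chi T) <= n`!%:R.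
Proof.
apply: le_trans (normc_sum_le _ _) _.
rewrite (eq_bigr (fun=> 1)) => [|p _]; last first.
  apply: complexI; rewrite -normC_normc normr_prod big1 // => i _.
  by rewrite normc_character.
rewrite sumr_const ler_nat.
have := card_inj_ffuns 'I_n G; rewrite cardG card_ord ffactnn => <-.
by apply/subset_leq_card/subsetP => p; rewrite !inE => /andP[].
Qed.

Lemma bij_norm0 : bij_norm set0 <= 1.
Proof.
rewrite /bij_norm cards0 subn0 ler_pdivrMr ?ltr0n ?fact_gt0 // mul1r.
exact: normc_bij_sum_le.
Qed.

Lemma bij_normU1 a T : a \notin T ->
  bij_norm (a |: T) = pivot_norm a (chi a) T.
Proof. by move=> aT; rewrite /bij_norm bij_sumU1 // cardsU1 aT. Qed.

(** The factor n - #|T| of [pivot_sum_rec] is exactly the ratio of the two normalizing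
    factorials. *)
Lemma pivot_norm_rec a c T : a \notin T -> is_character c ->
  pivot_norm a c T <= (n * (c == triv_char R G))%:R * bij_norm T +
    \sum_(i in T) pivot_norm i (char_mul c (chi i)) (T :\ i).
Proof.
move=> aT cc; have Tn := card_lt_notin aT.
have nT0 : 0 < (n - #|T|)%:R :> R by rewrite ltr0n subn_gt0.
have f0 : 0 < (n - #|T|)`!%:R :> R by rewrite ltr0n fact_gt0.
have -> : pivot_norm a c T =
    normc ((n - #|T|)%:R * pivot_sum chi a c T) / (n - #|T|)`!%:R.
  rewrite normcM normc_nat /pivot_norm subnS.
  by rewrite -{3}(prednK (_ : 0 < n - #|T|)%N) ?subn_gt0 // factS prednK ?subn_gt0 //
    natrM invfM mulrACA divff ?mul1r // gt_eqF.
rewrite pivot_sum_rec // sum_character // cardG ler_pdivrMr //.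
apply: le_trans (le_normcD _ _) _; rewrite normcM normc_nat normcN mulrDl.
rewrite -mulrA divfK ?gt_eqF // lerD2l mulr_suml.
apply: le_trans (normc_sum_le _ _) _; apply: ler_sum => i iT.
by rewrite /pivot_norm (cardsD1 i T) iT add1n divfK ?gt_eqF // ltr0n fact_gt0.
Qed.

Variable r : R.
Hypotheses (r0 : 0 < r) (r_le : r <= 2^-1).
Variable beta : {set 'I_n} -> R.
Hypothesis beta_ge0 : forall K, 0 <= beta K.
Hypothesis beta0 : beta set0 = 1.
Hypothesis beta_pair : forall a L, a \notin L ->
  \sum_(i in L | opposite a i) n%:R * beta (L :\ i) <= beta (a |: L).

(** [K] is the union of the 2-cycles, weighted by [beta]; the longer cycles live on the other points
    of [T]. *)
Definition bij_majorant T : R :=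
  \sum_(K : {set 'I_n} | K \subset T) beta K * cycle_bound n%:R r (#|T| - #|K|).

Definition pivot_majorant T : R :=
  \sum_(K : {set 'I_n} | K \subset T) beta K * path_bound n%:R r (#|T| - #|K|).

Lemma card_setD1 i T : i \in T -> #|T :\ i| = #|T|.-1.
Proof. by move=> iT; rewrite (cardsD1 i T) iT. Qed.

Lemma sum_pivot_majorant T :
  \sum_(i in T) pivot_majorant (T :\ i) = \sum_(K : {set 'I_n} | K \subset T)
    (beta K * path_bound n%:R r (#|T| - #|K|).-1) *+ (#|T| - #|K|).
Proof.
rewrite -sum_subset_avoid; apply: eq_bigr => i iT; apply: eq_bigr => K _.
by rewrite card_setD1 // -!subn1 subnAC.
Qed.

Lemma pivot_majorant_rec T :
  n%:R * bij_majorant T + \sum_(i in T) pivot_majorant (T :\ i) <= pivot_majorant T.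
Proof.
rewrite sum_pivot_majorant mulr_sumr -big_split /=; apply: ler_sum => K _.
rewrite mulrCA -mulrnAr -mulrDr ler_wpM2l //.
case: (_ - _)%N => [|j]; first by rewrite mulr0n addr0 path_bound0.
by rewrite /= -[_ *+ j.+1]mulr_natl path_bound_rec.
Qed.

(** The sets [K] avoiding [a] absorb, through [cycle_bound_rec], the paths still open after two
    steps; those containing [a] absorb, through [beta_pair], the 2-cycles of [a]. *)
Lemma bij_majorant_rec a T : a \notin T ->
  \sum_(i in T) ((n * opposite a i)%:R * bij_majorant (T :\ i) +
    \sum_(l in T :\ i) pivot_majorant (T :\ i :\ l)) <= bij_majorant (a |: T).
Proof.
move=> aT; rewrite big_split /= addrC /bij_majorant sum_subsetU1 //.
have aK K : K \subset T -> a \notin K by move=> KT; apply: contra aT => /(subsetP KT).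
apply: lerD.
  rewrite (eq_bigr (fun i => \sum_(K : {set 'I_n} | K \subset T :\ i)
    (beta K * path_bound n%:R r (#|T| - #|K|).-2) *+ (#|T| - #|K|).-1)); last first.
    move=> i iT; rewrite sum_pivot_majorant; apply: eq_bigr => K _.
    by rewrite card_setD1 // -[#|T|.-1]subn1 subnAC subn1.
  rewrite sum_subset_avoid; apply: ler_sum => K KT.
  rewrite -mulrnA -mulrnAr ler_wpM2l // cardsU1 aT add1n subSn ?subset_leq_card //.
  case: (_ - _)%N => [|[|j]]; rewrite ?muln0 ?mulr0n ?cycle_bound_ge0 //.
  by rewrite -[leLHS]mulr_natl mulnC cycle_bound_rec.
under eq_bigr do rewrite mulr_sumr.
rewrite sum_subset_del; apply: ler_sum => L LT.
rewrite !cardsU1 aT (aK L LT) !add1n subSS.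
rewrite (eq_bigr (fun i => (n * opposite a i)%:R * beta (L :\ i) *
   cycle_bound n%:R r (#|T| - #|L|))); last first.
  move=> i iL; rewrite !card_setD1 ?(subsetP LT) // mulrA.
  by have : (0 < #|L|)%N; [apply/card_gt0P; exists i | case: #|L| #|T| => [|l] // []].
rewrite -mulr_suml ler_wpM2r ?cycle_bound_ge0 //.
apply: le_trans (beta_pair (aK L LT)); rewrite big_mkcondr /=.
apply: ler_sum => i _; case: (opposite a i); rewrite ?muln1 //.
by rewrite muln0 mul0r.
Qed.

(* The bound on [bij_norm] unrolls two pivot steps: a cycle cannot close at the
   first one, as [chi a] is nontrivial, and closes at the second one only for an
   opposite pair; later closures are counted without restriction. *)
Lemma norms_le_majorants T : (forall i, i \in T -> chi i != triv_char R G) ->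
  bij_norm T <= bij_majorant T /\ forall a c, a \notin T -> is_character c ->
    pivot_norm a c T <= pivot_majorant T.
Proof.
have [N] := ubnP #|T|; elim: N T => // N IH T TN nontriv.
have IHdel i T' : T' \subset T -> i \in T' ->
    bij_norm (T' :\ i) <= bij_majorant (T' :\ i) /\
    forall a c, a \notin T' :\ i -> is_character c ->
      pivot_norm a c (T' :\ i) <= pivot_majorant (T' :\ i).
  move=> T'T iT'; apply: IH => [|l]; last first.
    by rewrite inE => /andP[_ lT']; apply/nontriv/(subsetP T'T).
  rewrite -ltnS (leq_trans _ TN) // ltnS (leq_trans _ (subset_leq_card T'T)) //.
  by rewrite [leqRHS](cardsD1 i) iT'.
have bijT : bij_norm T <= bij_majorant T.
  have [->|[a aT]] := set_0Vmem T.
    apply: le_trans bij_norm0 _; rewrite /bij_majorant (bigD1 set0) ?sub0set //=.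
    rewrite beta0 mul1r cards0 cycle_bound0 lerDl sumr_ge0 // => K _.
    by rewrite mulr_ge0 ?cycle_bound_ge0.
  have aTa : a \notin T :\ a by rewrite setD11.
  rewrite -(setD1K aT) bij_normU1 //; apply: le_trans (bij_majorant_rec aTa).
  apply: le_trans (pivot_norm_rec aTa (chi_char a)) _.
  rewrite (negPf (nontriv a aT)) muln0 mul0r add0r; apply: ler_sum => i iTa.
  have TaT : T :\ a \subset T by rewrite subsetDl.
  have [bij_i _] := IHdel i _ TaT iTa.
  have iTai : i \notin T :\ a :\ i by rewrite setD11.
  have cc : is_character (char_mul (chi a) (chi i)) by apply: is_character_mul.
  apply: le_trans (pivot_norm_rec iTai cc) _.
  apply: lerD; first by rewrite ler_wpM2l.
  apply: ler_sum => l lT; apply: (IHdel l _ _ lT).2; rewrite ?setD11 //.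
    by rewrite (subset_trans _ TaT) // subsetDl.
  exact: is_character_mul.
split=> // a c aT cc; apply: le_trans (pivot_norm_rec aT cc) _.
apply: le_trans (pivot_majorant_rec T); apply: lerD.
  case: eqP => _; rewrite ?muln1 ?muln0 ?mul0r ?ler_wpM2l //.
  by rewrite mulr_ge0 // sumr_ge0 // => K _; rewrite mulr_ge0 ?cycle_bound_ge0.
apply: ler_sum => i iT; apply: (IHdel i _ _ iT).2; rewrite ?setD11 //.
exact: is_character_mul.
Qed.

End Majorant.

(** * The final estimate *)

Lemma expR1_le4 (R : realType) : expR 1 <= 4 :> R.
Proof.
have h := expR_ge1Dx (- 2^-1 : R); rewrite expRN in h.
have e2 : expR 2^-1 <= 2 :> R.
  rewrite -[leLHS]invrK invf_ple ?posrE ?invr_gt0 ?expR_gt0 //; lra.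
have -> : 1 = 2^-1 + 2^-1 :> R by field.
rewrite expRD; have := expR_ge0 (2^-1 : R); nra.
Qed.

Lemma bin_le_exp2 n m : ('C(n, m) <= 2 ^ n)%N.
Proof.
elim: n m => [|n IH] [|m]; rewrite ?bin0 ?expn_gt0 //.
by rewrite binS expnS mul2n -addnn leq_add.
Qed.

(** Each of the m factors of n!/(n-m)! is at least n - m, and n <= e^(2x) (n - m) for x = m/n, since
    (1 + 2x)(1 - x) >= 1 when 0 <= x <= 1/2. *)
Lemma exp_fact_le (R : realType) (n m : nat) : (0 < n)%N -> (2 * m <= n)%N ->
  n%:R ^+ m * (n - m)`!%:R <= expR (2 * m%:R ^+ 2 / n%:R) * n`!%:R :> R.
Proof.
move=> n0 mn; have mn' : (m <= n)%N by lia.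
have n0R : 0 < n%:R :> R by rewrite ltr0n.
have mnR : 2 * m%:R <= n%:R :> R by rewrite -natrM ler_nat.
rewrite -(ffact_fact mn') natrM mulrA ler_wpM2r //.
have h : n%:R <= expR (2 * m%:R / n%:R) * (n - m)%:R :> R.
  rewrite natrB //; set x := m%:R / n%:R : R.
  have x0 : 0 <= x by rewrite divr_ge0.
  have x2 : x <= 2^-1 by rewrite ler_pdivrMr //; lra.
  have -> : n%:R - m%:R = n%:R * (1 - x) :> R by rewrite /x; field; rewrite gt_eqF.
  have ex := expR_ge1Dx (2 * x).
  have -> : 2 * m%:R / n%:R = 2 * x by rewrite mulrA.
  rewrite [leRHS]mulrCA ler_peMr ?(ltW n0R) //.
  apply: le_trans (_ : (1 + 2 * x) * (1 - x) <= _); first by nra.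
  by rewrite ler_wpM2r //; lra.
apply: (@le_trans _ _ ((expR (2 * m%:R / n%:R) * (n - m)%:R) ^+ m)).
  by rewrite lerXn2r ?nnegrE ?mulr_ge0 ?expR_ge0.
rewrite exprMn -expRM_natl [m%:R * _]mulrC mulrAC expr2 mulrA.
rewrite ler_wpM2l ?expR_ge0 // -natrX ler_nat.
elim: m {mn mn' mnR h} => [|m IH]; first by rewrite ffactn0.
rewrite ffactnSr expnSr leq_mul ?leq_sub2l // (leq_trans _ IH) //.
by case: m {IH} => // m; rewrite leq_exp2r // leq_sub2l.
Qed.

Lemma sum_half_exp (R : realFieldType) m : \sum_(k < m.+1) (2^-1 : R) ^+ (m - k) <= 2.
Proof.
elim: m => [|m IH]; first by rewrite big_ord1 expr0; lra.
rewrite big_ord_recr /= subnn expr0.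
have -> : \sum_(k < m.+1) (2^-1 : R) ^+ (m.+1 - k) =
    2^-1 * \sum_(k < m.+1) 2^-1 ^+ (m - k).
  by rewrite mulr_sumr; apply: eq_bigr => k _; rewrite subSn -1?ltnS // exprS.
lra.
Qed.

Lemma sum_subset_card (I : finType) (V : nmodType) (T : {set I}) (f : nat -> V) :
  \sum_(K : {set I} | K \subset T) f #|K| = \sum_(k < #|T|.+1) f k *+ 'C(#|T|, k).
Proof.
rewrite (partition_big (fun K : {set I} => inord #|K| : 'I_#|T|.+1) predT) //=.
apply: eq_bigr => k _; rewrite -cards_draws -sumr_const.
apply: eq_big => [K|K /andP[KT /eqP<-]]; last first.
  by rewrite inordK // ltnS subset_leq_card.
rewrite inE; case KT: (K \subset T) => //=.
by rewrite -val_eqE /= inordK // ltnS subset_leq_card.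
Qed.

(** With j = m - #|K|, binomial times j! is at most m^j, and m/r <= A/2: the terms grouped by #|K|
    are dominated by A^m 2^(-j) times the exponential. *)
Lemma sum_cycle_bound_le (R : realType) (I : finType) (T : {set I}) (A r nu : R) :
  0 <= nu -> 0 < r -> 0 <= A -> 2 * #|T|%:R <= A * r ->
  \sum_(K : {set I} | K \subset T) A ^+ #|K| * cycle_bound nu r (#|T| - #|K|) <=
  2 * A ^+ #|T| * expR (2 * nu * r ^+ 3).
Proof.
move=> nu0 r0 A0; set m := #|T| => mA.
rewrite (sum_subset_card T (fun k => A ^+ k * cycle_bound nu r (m - k))) -/m.
set E := expR _; have E0 : 0 <= E by apply: expR_ge0.
apply: (@le_trans _ _ (\sum_(k < m.+1) A ^+ m * E * 2^-1 ^+ (m - k))); last first.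
  rewrite -mulr_sumr -[leRHS]mulrA [leRHS]mulrC ler_wpM2l ?sum_half_exp //.
  by rewrite mulr_ge0 ?exprn_ge0.
apply: ler_sum => k _; have km : (k <= m)%N by rewrite -ltnS.
set j := (m - k)%N; have -> : A ^+ m = A ^+ k * A ^+ j by rewrite -exprD subnKC.
rewrite -mulrnAr -!mulrA ler_wpM2l ?exprn_ge0 //.
have Ej : exp_partial (2 * nu * r ^+ 3) j <= E.
  by apply: exp_partial_le; rewrite !mulr_ge0 ?exprn_ge0 // ltW.
rewrite -mulr_natl /cycle_bound mulrA [_ * (j`!%:R * _)]mulrA -natrM.
have -> : ('C(m, k) * j`! = m ^_ j)%N by rewrite -bin_sub // bin_ffact.
have ffj : (m ^_ j)%:R <= m%:R ^+ j :> R.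
  rewrite -natrX ler_nat; elim: (j) => // l IH.
  by rewrite ffactnSr expnSr leq_mul // leq_subr.
rewrite mulrAC [E * _]mulrC [leRHS]mulrA; apply: ler_pM => //.
- by rewrite divr_ge0 // exprn_ge0 // ltW.
- by apply: exp_partial_ge0; rewrite !mulr_ge0 ?exprn_ge0 // ltW.
rewrite -exprMn ler_pdivrMr ?exprn_gt0 // (le_trans ffj) // -exprMn.
rewrite lerXn2r ?nnegrE //; last by lra.
by rewrite mulr_ge0 ?divr_ge0 // ltW.
Qed.

Section Characters.
Variables (R : realType) (G : finZmodType) (n : nat).
Variable chi : 'I_n -> {ffun G -> R[i]}.
Hypothesis cardG : #|G| = n.
Hypothesis chi_char : forall i, is_character (chi i).

Lemma character_neq0 (c : {ffun G -> R[i]}) x : is_character c -> c x != 0.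
Proof. by move=> cc; rewrite -normr_gt0 normc_character. Qed.

Lemma opposite_sym : symmetric (opposite chi).
Proof.
by move=> a i; congr (_ == _); apply/ffunP => x; rewrite !ffunE mulrC.
Qed.

(** The classes must form a finite type, so they are taken in the image of [chi]. *)
Definition coord_class (i : 'I_n) : seq_sub (codom chi) := SeqSub (codom_f chi i).

Lemma coord_classE a l : (coord_class a == coord_class l) = (chi a == chi l).
Proof. by []. Qed.

Lemma opposite_same a i l : opposite chi a i ->
  (coord_class a == coord_class l) = opposite chi i l.
Proof.
rewrite coord_classE => /eqP/ffunP ai; apply/eqP/eqP => [al|il].
  by apply/ffunP => x; rewrite -ai !ffunE -al mulrC.
apply/ffunP => x; apply: (mulfI (character_neq0 x (chi_char i))).
move/ffunP: il => /(_ x); rewrite ffunE => ->; rewrite -ai ffunE mulrC //.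
Qed.

Lemma normc_hat1S : normc (hat1S chi) =
  normc (bij_sum chi [set i | chi i != triv_char R G]) / n%:R ^+ n.
Proof.
rewrite /hat1S normcM mulrC; congr (_ * _); last first.
  by rewrite normcV -natrX normc_nat natrX.
congr normc; apply: eq_bigr => p _; rewrite [RHS]big_mkcond /=.
by apply: eq_bigr => i _; rewrite inE; case: eqP => //= ->; rewrite ffunE.
Qed.

Lemma bij_norm_le (L r : R) (T : {set 'I_n}) :
  0 < r -> r <= 2^-1 -> (0 < #|T|)%N ->
  #|T|%:R <= 2 * L -> L <= #|T|%:R ->
  2 * #|T|%:R <= Num.sqrt (L / expR 1) * Num.sqrt n%:R * r ->
  (forall i, i \in T -> chi i != triv_char R G) ->
  (forall l, chi l != triv_char R G -> order_le2 (chi l) ->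
    (mult_coord chi (chi l))%:R <= L) ->
  bij_norm chi T <= (expR 1 * #|T|%:R) ^+ 2 *
    (2 * (Num.sqrt (L / expR 1) * Num.sqrt n%:R) ^+ #|T| * expR (2 * n%:R * r ^+ 3)).
Proof.
move=> r0 r_le T0 TL LT Ar nontriv multL.
pose B := pairing_bound coord_class (opposite chi) R.
(* A matching of [K] has #|K|/2 pairs, each a cycle of weight n. *)
pose beta K : R := B K * Num.sqrt n%:R ^+ #|K|.
have B0 K : 0 <= B K by apply: pairing_bound_ge0.
have beta_ge0 K : 0 <= beta K by rewrite mulr_ge0 ?exprn_ge0 ?sqrtr_ge0.
have beta0 : beta set0 = 1 by rewrite /beta /B pairing_bound0 cards0 expr0 mulr1.
have beta_pair a (L' : {set 'I_n}) : a \notin L' ->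
    \sum_(i in L' | opposite chi a i) n%:R * beta (L' :\ i) <= beta (a |: L').
  move=> aL; have := sum_pairing_bound opposite_sym opposite_same R aL.
  rewrite -/B => /(ler_wpM2r (exprn_ge0 (#|L'|.+1) (sqrtr_ge0 (n%:R : R)))).
  rewrite {2}/beta cardsU1 aL add1n; apply: le_trans.
  rewrite mulr_suml; apply: ler_sum => i /andP[iL _].
  rewrite /beta [#|L'|](cardsD1 i) iL add1n !exprS mulrCA.
  by rewrite [Num.sqrt _ * (Num.sqrt _ * _)]mulrA -[Num.sqrt _ * _]expr2 sqr_sqrtr.
have [le_maj _] :=
  norms_le_majorants cardG chi_char r0 r_le beta_ge0 beta0 beta_pair nontriv.
apply: le_trans le_maj _; set A := Num.sqrt (L / expR 1) * _ in Ar *.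
have A0 : 0 <= A by rewrite mulr_ge0 ?sqrtr_ge0.
apply: le_trans (ler_wpM2l _ (sum_cycle_bound_le (ler0n R n) r0 A0 Ar)); last first.
  by rewrite exprn_ge0 // mulr_ge0 ?expR_ge0.
rewrite mulr_sumr; apply: ler_sum => K KT.
rewrite [leRHS]mulrA ler_wpM2r ?cycle_bound_ge0 // /beta /A.
rewrite [(_ * Num.sqrt n%:R) ^+ _]exprMn [leRHS]mulrA ler_wpM2r ?exprn_ge0 ?sqrtr_ge0 //.
apply: (pairing_bound_le opposite_same T0 (subset_leq_card KT) TL LT) => l ll.
(* A class meeting [K] has a representative in [T], so its character is nontrivial and [multL]
   applies. *)
have [->|] := posnP (class_card coord_class K (coord_class l)); first by lra.
case/card_gt0P=> i; rewrite inE coord_classE => /andP[iK /eqP il].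
apply: le_trans (multL l _ _); last 2 first.
- by rewrite -il nontriv // (subsetP KT).
- by move=> x; move/eqP/ffunP/(_ x): ll; rewrite !ffunE expr2.
rewrite ler_nat; apply/subset_leq_card/subsetP => k.
by rewrite !inE => /andP[_].
Qed.

End Characters.

(** From C(n, m) <= 2^n <= e^n and (1 - delta)^m >= 2^(-m) >= e^(-m). *)
Lemma bin_le_expR (R : realType) (n m : nat) (delta X : R) :
  delta <= 2^-1 -> n%:R + m%:R <= 2 * X ->
  Num.sqrt 'C(n, m)%:R <= expR X * Num.sqrt ((1 - delta) ^+ m).
Proof.
move=> d1 nmX; have e2 : 2 <= expR 1 :> R by have := expR_ge1Dx (1 : R); lra.
apply: sqrtr_le_sqr; first by rewrite mulr_ge0 ?expR_ge0 ?sqrtr_ge0.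
rewrite exprMn sqr_sqrtr; last by rewrite exprn_ge0 //; lra.
have n2 : 'C(n, m)%:R <= expR n%:R :> R.
  apply: (@le_trans _ _ (2 ^+ n)); first by rewrite -natrX ler_nat bin_le_exp2.
  by rewrite -[n%:R]mulr1 expRM_natl lerXn2r ?nnegrE ?expR_ge0.
have m2 : expR (- m%:R) <= (1 - delta) ^+ m.
  rewrite -[m%:R]mulr1 -mulrN expRM_natl lerXn2r ?nnegrE ?expR_ge0 //; first lra.
  rewrite expRN; apply: (@le_trans _ _ 2^-1); last lra.
  by rewrite lef_pV2 ?posrE ?expR_gt0.
apply: le_trans n2 _; apply: (@le_trans _ _ (expR X ^+ 2 * expR (- m%:R))).
  by rewrite -expRM_natl -expRD ler_expR; lra.
by rewrite ler_wpM2l ?exprn_ge0 ?expR_ge0.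
Qed.

Lemma sqrt_bin_fact (R : rcfType) (n m : nat) : (m <= n)%N ->
  Num.sqrt 'C(n, m)%:R * (Num.sqrt m`!%:R * Num.sqrt (n - m)`!%:R) =
  Num.sqrt n`!%:R :> R.
Proof. by move=> mn; rewrite -!sqrtrM // -!natrM bin_fact. Qed.

Theorem theorem4p2 (R : realType) :
  exists C : R, forall (G : finZmodType) (n : nat) (delta : R)
    (chi : 'I_n -> {ffun G -> R[i]}) (m : nat),
    #|G| = n ->
    (forall i, is_character (chi i)) ->
    0 <= delta <= 2^-1 ->
    n_nontriv chi = m ->
    (2 * m <= n)%N ->
    (forall c : {ffun G -> R[i]}, is_character c -> c != triv_char R G ->
        order_le2 c -> (mult_coord chi c)%:R <= (1 - delta) * m%:R) ->
    `|hat1S chi| <=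
      ((expR (C * (m%:R * Num.sqrt m%:R / Num.sqrt n%:R + Num.sqrt m%:R))
        * Num.sqrt ((1 - delta) ^+ m)
        / Num.sqrt ('C(n, m))%:R
        * (n`!)%:R / (n%:R ^+ n) : R)%:C%C).
Proof.
(* With s = m^(1/2) and M = m^(3/2)/n^(1/2), the case n < 144 m needs n + m <= 145 m <= 1740 M <= 2
   X, the other case 7 s + 433 M <= X. *)
exists 1000 => G n delta chi m cardG chi_char /andP[d0 d1] nm mn multc.
have n0 : (0 < n)%N by rewrite -cardG; apply/card_gt0P; exists 0.
have mn' : (m <= n)%N by lia.
rewrite normC_normc lecR normc_hat1S ler_wpM2r ?invr_ge0 ?exprn_ge0 //.
set T := [set i | _]; have {nm} cT : #|T| = m by [].
set s := Num.sqrt m%:R; set q := Num.sqrt n%:R.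
set M := _ / q; set X := 1000 * _; set D := (1 - delta) ^+ m.
have s0 : 0 <= s by apply: sqrtr_ge0.
have q0 : 0 < q by rewrite sqrtr_gt0 ltr0n.
have sE : m%:R = s ^+ 2 by rewrite sqr_sqrtr.
have qE : n%:R = q ^+ 2 by rewrite sqr_sqrtr.
have M0 : 0 <= M by rewrite divr_ge0 ?mulr_ge0 // ltW.
have C0 : 0 < Num.sqrt 'C(n, m)%:R :> R by rewrite sqrtr_gt0 ltr0n bin_gt0.
(* The threshold 144 ensures r = 6 s / q <= 1/2 in the main case. *)
have [/orP triv_case|] := boolP ((m == 0) || (n < 144 * m))%N.
  apply: le_trans (normc_bij_sum_le cardG chi_char T) _.
  rewrite ler_peMl // ler_pdivlMr // mul1r.
  case: triv_case => [/eqP m0|nm].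
    rewrite /D m0 bin0 expr0 sqrtr1 mulr1 -[leLHS]expR0 ler_expR.
    by rewrite mulr_ge0 ?addr_ge0.
  apply: bin_le_expR => //.
  have q12 : q <= 12 * s.
    apply: sqrtr_le_sqr; first by rewrite mulr_ge0.
    rewrite exprMn -sE; have : n%:R <= (144 * m)%:R :> R by rewrite ler_nat ltnW.
    by rewrite natrM; lra.
  have mM : m%:R <= 12 * M.
    rewrite /M mulrA ler_pdivlMr // mulrCA ler_wpM2l //.
  have : n%:R <= (144 * m)%:R :> R by rewrite ler_nat ltnW.
  by rewrite natrM /X; lra.
rewrite negb_or -lt0n -leqNgt => /andP[m0 m144].
have s1 : 1 <= s by rewrite -[leLHS]sqrtr1 ler_wsqrtr // ler1n.
have s12 : 12 * s <= q.
  have : (144 * m)%:R <= n%:R :> R by rewrite ler_nat.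
  rewrite natrM => h; rewrite -[12 * s]ger0_norm ?mulr_ge0 // -sqrtr_sqr.
  by rewrite ler_wsqrtr // exprMn -sE; lra.
(* The ratio condition 2 m <= u q r = 6 u s amounts to s <= 3 u, which follows from m <= 2 L and e
   <= 4; moreover 2 n r^3 = 432 M. *)
pose r : R := 6 * s / q; pose L := (1 - delta) * m%:R.
have r0 : 0 < r by rewrite divr_gt0 // mulr_gt0 // (lt_le_trans _ s1).
have r_le : r <= 2^-1 by rewrite ler_pdivrMr //; lra.
have m1 : 1 <= m%:R :> R by rewrite ler1n.
have mL : m%:R <= 2 * L by rewrite /L; nra.
have Lm : L <= m%:R by rewrite /L; nra.
have e0 := expR_gt0 (1 : R).
set u := Num.sqrt (L / expR 1).
have u0 : 0 <= u by apply: sqrtr_ge0.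
have su : s <= 3 * u.
  have -> : 3 * u = Num.sqrt (9 * (L / expR 1)).
    rewrite sqrtrM // -/u; congr (_ * _); rewrite -[LHS]ger0_norm // -sqrtr_sqr.
    by congr Num.sqrt; ring.
  rewrite ler_wsqrtr // mulrA ler_pdivlMr //.
  by have := expR1_le4 R; nra.
have Ar : 2 * m%:R <= u * q * r.
  have -> : u * q * r = 6 * u * s by rewrite /r; field; rewrite gt_eqF.
  by rewrite sE; nra.
have rM : 2 * n%:R * r ^+ 3 = 432 * M.
  by rewrite /r /M qE sE; field; rewrite gt_eqF.
have := @bij_norm_le R G n chi cardG chi_char L r T r0 r_le.
rewrite cT => /(_ m0 mL Lm Ar) bij_le.
have {}bij_le : bij_norm chi T <=
    (expR 1 * m%:R) ^+ 2 * (2 * (u * q) ^+ m * expR (432 * M)).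
  rewrite -rM; apply: bij_le => [i|l nl l2]; first by rewrite inE.
  exact: multc.
move: bij_le; rewrite /bij_norm cT ler_pdivrMr ?ltr0n ?fact_gt0 // => bij_le.
rewrite mulrAC ler_pdivlMr //.
apply: le_trans (ler_wpM2r (ltW C0) bij_le) _.
set F1 := Num.sqrt m`!%:R : R; set F2 := Num.sqrt (n - m)`!%:R : R.
set F3 := Num.sqrt n`!%:R : R; set B := Num.sqrt 'C(n, m)%:R in C0 *.
have BF : B * (F1 * F2) = F3 by apply: sqrt_bin_fact.
have F20 : 0 <= F2 by apply: sqrtr_ge0.
have F30 : 0 <= F3 by apply: sqrtr_ge0.
have F2E : (n - m)`!%:R = F2 ^+ 2 by rewrite sqr_sqrtr.
have F3E : n`!%:R = F3 ^+ 2 by rewrite sqr_sqrtr.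
have D0 : 0 <= D by rewrite exprn_ge0 //; lra.
(* Squared, this is (1 - delta)^m (m/e)^m <= (1 - delta)^m m!. *)
have um : u ^+ m <= Num.sqrt D * F1.
  rewrite -sqrtrM // -[u ^+ m]ger0_norm ?exprn_ge0 // -sqrtr_sqr ler_wsqrtr //.
  rewrite exprAC sqr_sqrtr; last by rewrite divr_ge0 ?ltW //; lra.
  by rewrite /L -mulrA exprMn ler_wpM2l // fact_ge_expR.
(* Squared, this is [exp_fact_le], as m^2/n = m (s/q)^2 <= M. *)
have qm : F2 * q ^+ m <= expR M * F3.
  rewrite -[expR M]ger0_norm ?expR_ge0 // -sqrtr_sqr -sqrtrM ?sqr_ge0 //.
  rewrite -[F2 * _]ger0_norm ?mulr_ge0 ?exprn_ge0 ?(ltW q0) // -sqrtr_sqr.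
  rewrite ler_wsqrtr // exprMn -F2E [(q ^+ m) ^+ 2]exprAC -qE mulrC.
  apply: le_trans (exp_fact_le R n0 mn) _; rewrite ler_wpM2r // -expRM_natl ler_expR.
  rewrite -mulrA ler_wpM2l // /M expr2 -mulrA -[leRHS]mulrA ler_wpM2l //.
  have -> : m%:R / n%:R = (s / q) * (s / q) by rewrite sE qE mulf_div.
  by rewrite ler_piMr ?divr_ge0 ?(ltW q0) // ler_pdivrMr // mul1r; lra.
(* As s >= 1, 2 e^2 <= e^3 <= e^(3 s), and m^2 = s^4 <= e^(4 s). *)
have ES : 2 * (expR 1 * m%:R) ^+ 2 <= expR (7 * s).
  have -> : expR (7 * s) = expR s ^+ 3 * expR s ^+ 4.
    by rewrite -exprD -expRM_natl.
  have e2 : 2 <= expR 1 :> R by have := expR_ge1Dx (1 : R); lra.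
  have es : s <= expR s by have := expR_ge1Dx s; lra.
  have e1s : expR 1 <= expR s by rewrite ler_expR.
  have -> : 2 * (expR 1 * m%:R) ^+ 2 = (2 * expR 1 ^+ 2) * s ^+ 4.
    by rewrite sE; ring.
  apply: ler_pM; rewrite ?mulr_ge0 ?exprn_ge0 ?(ltW e0) //; last first.
    by rewrite lerXn2r ?nnegrE ?expR_ge0.
  apply: (@le_trans _ _ (expR 1 ^+ 3)); last by rewrite lerXn2r ?nnegrE ?expR_ge0.
  by rewrite [leRHS]exprS ler_wpM2r ?exprn_ge0 ?(ltW e0).
(* After [um], the identity B F1 F2 = F3 trades the binomial factor and one F2 for F3. *)
apply: (@le_trans _ _ ((2 * (expR 1 * m%:R) ^+ 2) * expR (432 * M) * Num.sqrt D *
    (F2 * q ^+ m) * F3)).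
  pose Z := 2 * (expR 1 * m%:R) ^+ 2 * expR (432 * M) * q ^+ m * F2 ^+ 2 * B.
  have Z0 : 0 <= Z.
    by rewrite /Z !(mulr_ge0, exprn_ge0) ?expR_ge0 ?(ltW C0) ?(ltW q0) ?(ltW e0).
  have := ler_wpM2l Z0 um; rewrite F2E -BF [(u * q) ^+ m]exprMn /Z.
  move: (q ^+ m) (u ^+ m) (expR (432 * M)) (expR 1) => Q U E e.
  by clearbody B F1 F2; congr (_ <= _); ring.
rewrite F3E; apply: (@le_trans _ _
    (expR (7 * s) * expR (432 * M) * Num.sqrt D * (expR M * F3) * F3)).
  rewrite ler_wpM2r // ler_pM // ?mulr_ge0 ?exprn_ge0 ?(ltW q0) ?expR_ge0 ?sqrtr_ge0 //.
  by rewrite !ler_wpM2r ?expR_ge0 ?sqrtr_ge0.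
have -> : expR (7 * s) * expR (432 * M) * Num.sqrt D * (expR M * F3) * F3 =
    expR (7 * s + 432 * M + M) * Num.sqrt D * F3 ^+ 2 by rewrite !expRD; ring.
rewrite ler_wpM2r ?exprn_ge0 // ler_wpM2r ?sqrtr_ge0 // ler_expR /X; lra.
Qed.
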